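(* Let $\mathbb{F}$ be a field (of arbitrary characteristic and cardinality) and let $A=A_0\oplus A_1$ be a finite dimensional alternative superalgebra over $\mathbb{F}$. If the right multiplication operator $R_a$ is nilpotent for every $a\in A_0\cup A_1$, then $A$ is nilpotent. In particular, every finite dimensional Engelian alternative superalgebra over $\mathbb{F}$ is nilpotent.
   Context: Algebras are not assumed associative or unital. The associator is $(x,y,z)=(xy)z-x(yz)$; an algebra is alternative if $(x,x,y)=0$ and $(x,y,y)=0$ hold identically. A superalgebra over $\mathbb{F}$ is an algebra $A=A_0\oplus A_1$ with subspaces $A_0,A_1$ such that $A_iA_j\subseteq A_{i+j \bmod 2}$. Elements of $A_0\cup A_1$ are homogeneous; for nonzero homogeneous $x$, $|x|=0$ if $x\in A_0$ (even) and $|x|=1$ if $x\in A_1$ (odd). Let $G=G_0\oplus G_1$ be the Grassmann algebra over $\mathbb{F}$: the unital associative algebra generated by $e_1,e_2,\dots$ with $e_ie_j=-e_je_i$ and $e_i^2=0$, where $G_0$ is spanned by $1$ and the products of an even number of $e_i$'s and $G_1$ is spanned by the products of an odd number of $e_i$'s. The Grassmann envelope of $A$ is $G(A)=G_0\otimes A_0\oplus G_1\otimes A_1$ with product $(x\otimes u)(y\otimes v)=xy\otimes uv$. The superalgebra $A$ is called an alternative superalgebra if $G(A)$ is an alternative algebra. Such an $A$ satisfies, for all nonzero homogeneous $x,y,z$ and all $a\in A_0$: $(x,y,z)+(-1)^{|y||z|}(x,z,y)=0$, $(x,y,z)+(-1)^{|x||y|}(y,x,z)=0$, and $(a,a,x)=0$.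 For homogeneous $x$, the operators $R_x,L_x\in \mathrm{End}_{\mathbb{F}}A$ are defined by $R_x(y)=(-1)^{|x||y|}yx$ for homogeneous $y$ (extended linearly) and $L_x(y)=xy$; $R_0=L_0=0$. A homogeneous element $x$ is Engelian if the associative (not necessarily unital) subalgebra of $\mathrm{End}_{\mathbb{F}}A$ generated by $R_x$ and $L_x$ is nilpotent; $A$ is Engelian if every homogeneous element of $A$ is Engelian. An algebra is nilpotent if there is a positive integer $n$ such that every product of $n$ of its elements, with any arrangement of parentheses, is zero. *)

(* Defs.v *)
From HB Require Import structures.
From mathcomp Require Import all_boot all_algebra.
From mathcomp Require Import finmap.
From mathcomp.multinomials Require Import monalg.

Set Implicit Arguments.
Unset Strict Implicit.
Unset Printing Implicit Defensive.

Import GRing.Theory.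
Local Open Scope ring_scope.

Section Algebras.
Variables (V : zmodType) (op : V -> V -> V) (D : V -> Prop).

Definition associator (x y z : V) : V := op (op x y) z - op x (op y z).

(* The algebra is the subset [D] of [V], with product [op]. *)
Definition alternative_on : Prop :=
  forall x y, D x -> D y -> associator x x y = 0 /\ associator x y y = 0.

(* [is_product n x]: x is a product of n elements of [D], bracketed somehow. *)
Inductive is_product : nat -> V -> Prop :=
| is_product1 x : D x -> is_product 1 x
| is_productM m n x y :
    is_product m x -> is_product n y -> is_product (m + n)%N (op x y).

Definition nilpotent_on : Prop :=
  exists2 n, (0 < n)%N & forall x, is_product n x -> x = 0.

End Algebras.

Definition nilpotent_algebra (V : zmodType) (op : V -> V -> V) : Prop :=
  nilpotent_on op (fun _ => True).

(* The non-unital subalgebra of (V, op) generated by X. *)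
Inductive generated_subalgebra (F : fieldType) (V : lmodType F)
    (op : V -> V -> V) (X : V -> Prop) : V -> Prop :=
| gen_incl x : X x -> generated_subalgebra op X x
| gen_zero : generated_subalgebra op X 0
| gen_add x y : generated_subalgebra op X x -> generated_subalgebra op X y ->
    generated_subalgebra op X (x + y)
| gen_scale c x : generated_subalgebra op X x ->
    generated_subalgebra op X (c *: x)
| gen_mul x y : generated_subalgebra op X x -> generated_subalgebra op X y ->
    generated_subalgebra op X (op x y).

(* The Grassmann algebra G has as basis the products e_S = e_{i1} ... e_{ik}  *)
(* with S = {i1 < ... < ik} a finite subset of nat, and                       *)
(*   e_S e_T = (-1)^(inv S T) e_{S u T}   if S and T are disjoint, else 0,    *)
(* where inv S T counts the transpositions needed to sort the product.        *)
(* Hence {malg F[{fset nat}]} is G and {malg A[{fset nat}]} is G (x) A, the   *)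
(* coefficient at S being the factor in A of e_S.                             *)

Definition inversions (S T : {fset nat}) : nat :=
  (\sum_(i <- S) \sum_(j <- T) (j < i))%N.

Section Grassmann.
Variable F : fieldType.

Section Product.
Variables (U V W : lmodType F) (op : U -> V -> W).

Definition grass_monom_mul (S T : {fset nat}) (w : W) : {malg W[{fset nat}]} :=
  if [disjoint S & T]%fset
  then << (-1) ^+ inversions S T *: w *g (S `|` T)%fset >> else 0.

(* (sum_S e_S (x) u_S) (sum_T e_T (x) v_T) = sum_{S,T} e_S e_T (x) op u_S v_T *)
Definition grass_mul (f : {malg U[{fset nat}]}) (g : {malg V[{fset nat}]}) :
    {malg W[{fset nat}]} :=
  \sum_(S <- msupp f) \sum_(T <- msupp g) grass_monom_mul S T (op f@_S g@_T).

End Product.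

Section ProductTheory.
Variables (U V W : lmodType F) (op : U -> V -> W).
Hypothesis opDl : forall v, {morph op^~ v : u1 u2 / u1 + u2}.
Hypothesis opDr : forall u, {morph op u : v1 v2 / v1 + v2}.

Local Lemma op0l v : op 0 v = 0.
Proof. by apply: (addrI (op 0 v)); rewrite -opDl !addr0. Qed.

Local Lemma op0r u : op u 0 = 0.
Proof. by apply: (addrI (op u 0)); rewrite -opDr !addr0. Qed.

Lemma grass_monom_mul0 S T : grass_monom_mul S T (0 : W) = 0.
Proof. by rewrite /grass_monom_mul scaler0 monalgU0 if_same. Qed.

Lemma grass_monom_mulD S T : {morph @grass_monom_mul W S T : x y / x + y}.
Proof.
move=> x y; rewrite /grass_monom_mul; case: [disjoint S & T]%fset.
  by rewrite scalerDr; exact: monalgUD.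
exact: (esym (addr0 0)).
Qed.

Lemma grass_mulEw (d1 d2 : {fset {fset nat}}) f g :
  (msupp f `<=` d1)%fset -> (msupp g `<=` d2)%fset ->
  grass_mul op f g =
  \sum_(S <- d1) \sum_(T <- d2) grass_monom_mul S T (op f@_S g@_T).
Proof.
move=> le1 le2; rewrite /grass_mul (big_fset_incl _ le1) /=; last first.
  move=> S _ /mcoeff_outdom ->; rewrite big1 // => T _.
  by rewrite op0l grass_monom_mul0.
apply: eq_bigr => S _; apply: big_fset_incl => // T _ /mcoeff_outdom ->.
by rewrite op0r grass_monom_mul0.
Qed.

Lemma grass_mulDl g : {morph grass_mul op ^~ g : f1 f2 / f1 + f2}.
Proof.
move=> f1 f2; pose d := (msupp f1 `|` msupp f2)%fset.
rewrite !(@grass_mulEw d (msupp g)) ?fsubsetUl ?fsubsetUr ?msuppD_le //.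
rewrite -big_split; apply: eq_bigr => S _; rewrite -big_split.
by apply: eq_bigr => T _; rewrite mcoeffD opDl grass_monom_mulD.
Qed.

Lemma grass_mulDr f : {morph grass_mul op f : g1 g2 / g1 + g2}.
Proof.
move=> g1 g2; pose d := (msupp g1 `|` msupp g2)%fset.
rewrite !(@grass_mulEw (msupp f) d) ?fsubsetUl ?fsubsetUr ?msuppD_le //.
rewrite -big_split; apply: eq_bigr => S _; rewrite -big_split.
by apply: eq_bigr => T _; rewrite mcoeffD opDr grass_monom_mulD.
Qed.

Lemma grass_mulUU S T u v :
  grass_mul op << u *g S >> << v *g T >> = grass_monom_mul S T (op u v).
Proof.
rewrite (@grass_mulEw [fset S]%fset [fset T]%fset) ?msuppU_le //.
by rewrite !big_seq_fset1 !mcoeffUU.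
Qed.

Lemma grass_mul0l g : grass_mul op 0 g = 0.
Proof. by rewrite /grass_mul msupp0 big_seq_fset0. Qed.

Lemma grass_mul0r f : grass_mul op f 0 = 0.
Proof. by apply: big1 => S _; rewrite msupp0 big_seq_fset0. Qed.

Lemma grass_mul_suml I (r : seq I) (P : pred I) f g :
  grass_mul op (\sum_(i <- r | P i) f i) g =
  \sum_(i <- r | P i) grass_mul op (f i) g.
Proof. exact: (big_morph _ (grass_mulDl g) (grass_mul0l g)). Qed.

Lemma grass_mul_sumr I (r : seq I) (P : pred I) f g :
  grass_mul op f (\sum_(i <- r | P i) g i) =
  \sum_(i <- r | P i) grass_mul op f (g i).
Proof. exact: (big_morph _ (grass_mulDr f) (grass_mul0r f)). Qed.

End ProductTheory.

Definition grassmann : zmodType := {malg F^o[{fset nat}]}.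

Definition grassmann_mul : grassmann -> grassmann -> grassmann :=
  grass_mul (fun a b : F^o => a * b : F^o).

Definition grassmann_one : grassmann := << (1 : F^o) *g fset0 >>.
Definition grassmann_gen (i : nat) : grassmann := << (1 : F^o) *g [fset i]%fset >>.

Lemma grassmann_mulDl g : {morph grassmann_mul ^~ g : f1 f2 / f1 + f2}.
Proof. by apply: grass_mulDl => c a b; [exact: mulrDl | exact: mulrDr]. Qed.

Lemma grassmann_mulDr f : {morph grassmann_mul f : g1 g2 / g1 + g2}.
Proof. by apply: grass_mulDr => c a b; [exact: mulrDl | exact: mulrDr]. Qed.

Lemma grassmann_mulUU S T (a b : F^o) :
  grassmann_mul << a *g S >> << b *g T >> = grass_monom_mul S T (a * b : F^o).
Proof. by apply: grass_mulUU => c x y; [exact: mulrDl | exact: mulrDr]. Qed.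

Lemma grassmann_mul_suml I (r : seq I) f g :
  grassmann_mul (\sum_(i <- r) f i) g = \sum_(i <- r) grassmann_mul (f i) g.
Proof. by apply: grass_mul_suml => c x y; [exact: mulrDl | exact: mulrDr]. Qed.

Lemma grassmann_mul_sumr I (r : seq I) f g :
  grassmann_mul f (\sum_(i <- r) g i) = \sum_(i <- r) grassmann_mul f (g i).
Proof. by apply: grass_mul_sumr => c x y; [exact: mulrDl | exact: mulrDr]. Qed.

Local Lemma sum_fsetU (S T : {fset nat}) (f : nat -> nat) :
  [disjoint S & T]%fset ->
  (\sum_(i <- (S `|` T)%fset) f i = \sum_(i <- S) f i + \sum_(i <- T) f i)%N.
Proof.
move=> dST; rewrite -big_cat; apply: perm_big; apply: uniq_perm => //.
  rewrite cat_uniq !fset_uniq andbT /=; apply/hasPn => i iT.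
  by apply/negP => iS; move/fdisjointP: dST => /(_ i iS)/negP.
by move=> i; rewrite mem_cat in_fsetU.
Qed.

Lemma inversionsUl S T X : [disjoint S & T]%fset ->
  inversions (S `|` T)%fset X = (inversions S X + inversions T X)%N.
Proof. exact: sum_fsetU. Qed.

Lemma inversionsUr X S T : [disjoint S & T]%fset ->
  inversions X (S `|` T)%fset = (inversions X S + inversions X T)%N.
Proof.
move=> dST; rewrite /inversions -big_split /=.
by apply: eq_bigr => i _; rewrite sum_fsetU.
Qed.

Local Lemma assocD (V : zmodType) (m : V -> V -> V)
    (mDl : forall v, {morph m^~ v : x y / x + y})
    (mDr : forall v, {morph m v : x y / x + y}) x y z t :
  [/\ m x (m z t) = m (m x z) t -> m y (m z t) = m (m y z) t ->
        m (x + y) (m z t) = m (m (x + y) z) t,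
      m z (m x t) = m (m z x) t -> m z (m y t) = m (m z y) t ->
        m z (m (x + y) t) = m (m z (x + y)) t
    & m z (m t x) = m (m z t) x -> m z (m t y) = m (m z t) y ->
        m z (m t (x + y)) = m (m z t) (x + y)].
Proof. by split=> e1 e2; rewrite !(mDl, mDr) e1 e2. Qed.

Local Lemma grassmann_ind (P : grassmann -> Prop) : P 0 ->
  (forall f g, P f -> P g -> P (f + g)) ->
  (forall S (a : F^o), P << a *g S >>) -> forall f, P f.
Proof. by move=> P0 PD PU f; rewrite (monalgE f); apply: big_ind. Qed.

Lemma grassmann_mulA : associative grassmann_mul.
Proof.
have m0l f : grassmann_mul 0 f = 0 by exact: grass_mul0l.
have m0r f : grassmann_mul f 0 = 0 by exact: grass_mul0r.
have mD := assocD grassmann_mulDl grassmann_mulDr.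
move=> f g h; elim/grassmann_ind: f => [|f1 f2 IH1 IH2|S a].
- by rewrite !m0l.
- by case: (mD f1 f2 g h) => + _ _; apply.
elim/grassmann_ind: g => [|g1 g2 IH1 IH2|T b].
- by rewrite m0l !m0r m0l.
- by case: (mD g1 g2 << a *g S >> h) => _ + _; apply.
elim/grassmann_ind: h => [|h1 h2 IH1 IH2|X c].
- by rewrite (m0r << b *g T >>) m0r [RHS]m0r.
- by case: (mD h1 h2 << a *g S >> << b *g T >>) => _ _; apply.
rewrite !grassmann_mulUU /grass_monom_mul.
case: (boolP [disjoint S & T]%fset) => [dST|ndST]; last first.
  rewrite m0l; case: ifP => _; last by rewrite m0r.
  by rewrite grassmann_mulUU /grass_monom_mul fdisjointXU (negPf ndST).
case: (boolP [disjoint T & X]%fset) => [dTX|ndTX]; last first.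
  rewrite m0r grassmann_mulUU.
  by rewrite /grass_monom_mul fdisjointUX (negPf ndTX) andbF.
rewrite !grassmann_mulUU /grass_monom_mul fdisjointXU fdisjointUX dST dTX andbT /=.
case: ifP => // dSX; rewrite fsetUA; congr << _ *g _ >>.
rewrite inversionsUl // inversionsUr // !exprD /GRing.scale /=.
rewrite -!mulrA (mulrCA a).
rewrite (mulrCA ((-1) ^+ inversions T X) ((-1) ^+ inversions S T)).
by rewrite [RHS]mulrCA.
Qed.

Lemma grassmann_mul1l : left_id grassmann_one grassmann_mul.
Proof.
elim/grassmann_ind => [|f g IHf IHg|S a]; first exact: grass_mul0r.
  by rewrite grassmann_mulDr IHf IHg.
rewrite grassmann_mulUU /grass_monom_mul fdisjoint0X fset0U.
by rewrite /inversions big_seq_fset0 expr0 scale1r mul1r.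
Qed.

Lemma grassmann_mul1r : right_id grassmann_one grassmann_mul.
Proof.
elim/grassmann_ind => [|f g IHf IHg|S a]; first exact: grass_mul0l.
  by rewrite grassmann_mulDl IHf IHg.
rewrite grassmann_mulUU /grass_monom_mul fdisjointX0 fsetU0.
rewrite /inversions big1 => [|i _]; last by rewrite big_seq_fset0.
by rewrite expr0 scale1r mulr1.
Qed.

Lemma grassmann_gen_sqr i :
  grassmann_mul (grassmann_gen i) (grassmann_gen i) = 0.
Proof.
by rewrite grassmann_mulUU /grass_monom_mul fdisjoint1X in_fset1 eqxx.
Qed.

Lemma grassmann_gen_anticomm i j :
  grassmann_mul (grassmann_gen i) (grassmann_gen j) =
  - grassmann_mul (grassmann_gen j) (grassmann_gen i).
Proof.
rewrite !grassmann_mulUU /grass_monom_mul !fdisjoint1X !in_fset1 eq_sym.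
case: (ltngtP i j) => [ij|ji|_] /=; last by rewrite oppr0.
  rewrite fsetUC -monalgUN /inversions !big_seq_fset1 ij ltnNge (ltnW ij) /=.
  by rewrite expr0 expr1 scaleN1r opprK scale1r.
rewrite fsetUC -monalgUN /inversions !big_seq_fset1 ji ltnNge (ltnW ji) /=.
by rewrite expr0 expr1 scaleN1r scale1r.
Qed.

(* Iterating this, e_S is the increasing product of the generators in S. *)
Lemma grassmann_gen_mul i (S : {fset nat}) : (forall j, j \in S -> (i < j)%N) ->
  grassmann_mul (grassmann_gen i) << (1 : F^o) *g S >> =
  << (1 : F^o) *g (i |` S)%fset >>.
Proof.
move=> ltiS; rewrite grassmann_mulUU /grass_monom_mul fdisjoint1X.
rewrite ifT; last by apply/negP => /ltiS; rewrite ltnn.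
rewrite /inversions big_seq_fset1 big_seq big1 => [|j /ltiS ij].
  by rewrite expr0 scale1r mulr1.
by rewrite ltnNge (ltnW ij).
Qed.

Definition tens (A : lmodType F) (x : grassmann) (a : A) :
    {malg A[{fset nat}]} :=
  \sum_(S <- msupp x) << x@_S *: a *g S >>.

Section Tensors.
Variable A : lmodType F.
Implicit Type a : A.

Lemma tensEw (d : {fset {fset nat}}) x a : (msupp x `<=` d)%fset ->
  tens x a = \sum_(S <- d) << x@_S *: a *g S >>.
Proof.
move=> le; apply: big_fset_incl => // S _ /mcoeff_outdom ->.
by rewrite scale0r monalgU0.
Qed.

Lemma tens0l a : tens 0 a = 0.
Proof. by rewrite /tens msupp0 big_seq_fset0. Qed.

Lemma tensDl a : {morph (@tens A)^~ a : x y / x + y}.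
Proof.
move=> x y; pose d := (msupp x `|` msupp y)%fset.
rewrite !(@tensEw d) ?fsubsetUl ?fsubsetUr ?msuppD_le // -big_split.
by apply: eq_bigr => S _; rewrite mcoeffD scalerDl monalgUD.
Qed.

Lemma tensU S (c : F^o) a : tens << c *g S >> a = << c *: a *g S >>.
Proof.
by rewrite (@tensEw [fset S]%fset) ?msuppU_le // big_seq_fset1 mcoeffUU.
Qed.

End Tensors.

Lemma grass_mul_tens (A : lmodType F) (mul : {bilinear A -> A -> A}) x y u v :
  grass_mul mul (tens x u) (tens y v) = tens (grassmann_mul x y) (mul u v).
Proof.
have mDl w : {morph mul^~ w : u1 u2 / u1 + u2} by exact: linearDl.
have mDr w : {morph mul w : v1 v2 / v1 + v2} by exact: linearDr.
elim/grassmann_ind: x => [|x1 x2 IH1 IH2|S a].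
- by rewrite tens0l grass_mul0l /grassmann_mul grass_mul0l tens0l.
- rewrite [X in grass_mul _ X _]tensDl [LHS](grass_mulDl mDl mDr) IH1 IH2.
  by rewrite [X in _ = tens X _]grassmann_mulDl [RHS]tensDl.
elim/grassmann_ind: y => [|y1 y2 IH1 IH2|T b].
- by rewrite tens0l grass_mul0r /grassmann_mul grass_mul0r tens0l.
- rewrite [X in grass_mul _ _ X]tensDl [LHS](grass_mulDr mDl mDr) IH1 IH2.
  by rewrite [X in _ = tens X _]grassmann_mulDr [RHS]tensDl.
rewrite !tensU grass_mulUU // grassmann_mulUU /grass_monom_mul.
case: ifP => _; last by rewrite tens0l.
rewrite tensU linearZl_LR linearZr_LR /= !scalerA; congr << _ *: _ *g _ >>.
exact: mulrA.
Qed.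

End Grassmann.

Section Superalgebras.
Variables (F : fieldType) (A : vectType F).
Variables (mul : A -> A -> A) (A_ : bool -> {vspace A}).

(* A_ false is the even part and A_ true the odd part. *)
Definition superalgebra : Prop :=
  [/\ directv (A_ false + A_ true),
      (A_ false + A_ true)%VS = fullv
    & forall i j x y, x \in A_ i -> y \in A_ j -> mul x y \in A_ (i (+) j)].

(* G(A) as a subset of G (x) A: the part spanned by the e_S (x) a with a of  *)
(* the parity of #|S|. Its product is [grass_mul mul], see [grass_mul_tens]. *)
Definition grassmann_envelope (f : {malg A[{fset nat}]}) : Prop :=
  forall S : {fset nat}, f@_S \in A_ (odd #|` S|).

Definition alternative_superalgebra : Prop :=
  superalgebra /\ alternative_on (grass_mul mul) grassmann_envelope.

Definition homogeneous (x : A) : Prop := exists i, x \in A_ i.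

(* The component of y in A_ i. *)
Definition component (i : bool) (y : A) : A := daddv_pi (A_ i) (A_ (~~ i)) y.

(* |x| for x homogeneous and nonzero; the value at 0 is irrelevant. *)
Definition parity (x : A) : bool := x \in A_ true.

Definition Rop (x : A) : 'End(A) :=
  linfun (fun y => \sum_(j : bool)
    (-1) ^+ (parity x * j)%N *: mul (component j y) x).

Definition Lop (x : A) : 'End(A) := linfun (mul x).

Definition engelian_elt (x : A) : Prop :=
  nilpotent_on (@comp_lfun F A A A)
    (generated_subalgebra (@comp_lfun F A A A)
       (fun f => f = Rop x \/ f = Lop x)).

Definition engelian : Prop := forall x, homogeneous x -> engelian_elt x.

End Superalgebras.

Definition nilpotent_operator (F : fieldType) (A : vectType F) (f : 'End(A)) : Prop :=
  exists n, forall y, iter n f y = 0.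

Section OperatorTheory.
Variables (F : fieldType) (A : vectType F) (mul : {bilinear A -> A -> A}).
Variable A_ : bool -> {vspace A}.

Lemma LopE x y : Lop mul x y = mul x y.
Proof. exact: (lfunE (mul x)). Qed.

Lemma RopE i j x y : superalgebra mul A_ -> x \in A_ i -> y \in A_ j ->
  Rop mul A_ x y = (-1) ^+ (i * j)%N *: mul y x.
Proof.
case=> /directv_addP dA _ _ xi yj; have cap0 b : (A_ b :&: A_ (~~ b) = 0)%VS.
  by case: b; rewrite //= capvC.
pose f z := \sum_(k : bool)
  (-1) ^+ (parity A_ x * k)%N *: mul (component A_ k z) x.
have f_lin : linear f.
  move=> c z1 z2; rewrite /f scaler_sumr -big_split; apply: eq_bigr => k _ /=.
  by rewrite /component linearP linearPl scalerDr !scalerA mulrC.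
have -> : Rop mul A_ x y = f y.
  pose fL := HB.pack_for {linear A -> A} f
    (GRing.isLinear.Build F A A *:%R f f_lin).
  exact: (lfunE fL).
have compE k : component A_ k y = if k == j then y else 0.
  case: eqP => [->|/eqP kj]; first exact: daddv_pi_id.
  have -> : k = ~~ j by case: (k) (j) kj => [] [].
  have capC : (A_ (~~ j) :&: A_ j = 0)%VS by rewrite capvC.
  rewrite /component negbK; apply: (addIr y); rewrite add0r.
  rewrite -[in X in _ + X](daddv_pi_id (cap0 j) yj) daddv_pi_add //.
  exact: (subvP (addvSr _ _)).
rewrite /f (bigD1 j) //= big1 => [|k kj]; last first.
  by rewrite compE (negPf kj) linear0l scaler0.
rewrite compE eqxx addr0; have [->|x0] := eqVneq x 0.
  by rewrite linear0r !scaler0.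
suff -> : parity A_ x = i by [].
rewrite /parity; case: i xi => // x0A; apply: contraNF x0 => x1A.
by rewrite -memv0 -(cap0 false) memv_cap x0A.
Qed.

End OperatorTheory.

(* Main.v *)
(* The super-alternative identities for homogeneous a, b, read off from the    *)
(* Grassmann envelope, say that the right multiplications r_a form a weakly    *)
(* closed set: r_a r_b + (-1)^(|a||b|) r_b r_a is again a right                *)
(* multiplication; likewise for the left multiplications l_a. By Jacobson's    *)
(* theorem, the r_a generate a nilpotent associative algebra, so the chain     *)
(* K_0 = 0, K_{n+1} = {v | v A <= K_n} of graded two-sided ideals reaches A.   *)
(* For a even, l_a^(2^n) and r_a^(2^n) are the multiplications by a^(2^n),     *)
(* so l_a is nilpotent. For a odd, (a, a, v) = (v, a, a), so on K_{n+1}/K_n,   *)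
(* where A acts trivially on the right, l_a^2 is multiplication by the even    *)
(* element a^2, and l_a is nilpotent there. Jacobson's theorem applied to the  *)
(* left multiplications on each K_{n+1}/K_n shows that all long products of    *)
(* left and right multiplications vanish, hence so do all long products in A.  *)

From HB Require Import structures.
Require Import Defs.
From mathcomp Require Import all_boot all_algebra finmap.
From mathcomp.multinomials Require Import monalg.
From Stdlib Require Import Classical.

Set Implicit Arguments.
Unset Strict Implicit.
Unset Printing Implicit Defensive.

Import GRing.Theory.
Local Open Scope ring_scope.

(** Right and left multiplications by homogeneous elements are each weakly closed, so
    [weakly_closed_nilpotent] turns nilpotency of single operators into nilpotency of long words.
    Applied to right multiplications it makes the ideals [right_annihilators n] climb to the whole
    algebra. On each layer of this chain right multiplications act as zero, and nilpotency of left
    ones follows from that of right ones ([Lop_nilpotent_mod]); hence long mixed words vanish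
    ([words_map_right_annihilators]). Finally, in a bracketed product of [2 ^ N] elements, following
    the larger factor at every node exposes a word of [N] multiplications, so the product is
    zero. *)

Lemma exists_maximal (X : Type) (P : X -> Prop) (m : X -> nat) (M : nat) :
  (forall x, P x -> (m x <= M)%N) -> forall x0, P x0 ->
  exists2 x, P x & forall y, P y -> (m y <= m x)%N.
Proof.
move=> mM x0; have [k] := ubnP (M - m x0); elim: k x0 => // k IH x0 lk Px0.
have [|noy] := classic (exists2 y, P y & (m x0 < m y)%N).
  case=> y Py xy; apply: (IH y) => //.
  by rewrite -ltnS (leq_trans _ lk) // ltnS ltn_sub2l // (leq_trans xy) ?mM.
exists x0 => // y Py; rewrite leqNgt; apply/negP => xy.
by apply: noy; exists y.
Qed.

(** * Weakly closed sets of nilpotent operators *)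

Section WeaklyClosed.
Variables (F : fieldType) (V : vectType F).
Implicit Types (W : 'End(V) -> Prop) (S T U : {vspace V}) (s : seq 'End(V)).

Definition stable W U := forall f, W f -> forall u, u \in U -> f u \in U.

Lemma not_maps_into W U T :
  ~ (forall f, W f -> forall u, u \in U -> f u \in T) ->
  exists f u, [/\ W f, u \in U & f u \notin T].
Proof.
move=> nW; apply: NNPP => none; apply: nW => f Wf u uU.
by apply/negPn/negP => fuT; apply: none; exists f, u.
Qed.

Definition weakly_closed W := forall f g, W f -> W g ->
  exists c : F, W ((f \o g)%VF + c *: (g \o f)%VF).

Fixpoint act s (v : V) : V := if s is f :: s' then f (act s' v) else v.

Definition words_map W U T N := forall s, (forall f, f \in s -> W f) ->
  (N <= size s)%N -> forall u, u \in U -> act s u \in T.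

Lemma act_cat s1 s2 v : act (s1 ++ s2) v = act s1 (act s2 v).
Proof. by elim: s1 => //= f s1 ->. Qed.

Lemma act_stable W U s : stable W U -> (forall f, f \in s -> W f) ->
  forall u, u \in U -> act s u \in U.
Proof.
move=> WU; elim: s => //= f s IH sW u uU; apply: WU; first exact/sW/mem_head.
by apply: IH => // g gs; apply: sW; rewrite inE gs orbT.
Qed.

Lemma act_is_linear s : linear (act s).
Proof. by elim: s => //= f s IH c u v; rewrite IH linearP. Qed.

HB.instance Definition _ s :=
  GRing.isLinear.Build F V V *:%R (act s) (act_is_linear s).

Lemma words_map_trans W U T S N1 N2 :
  words_map W U T N1 -> words_map W T S N2 -> words_map W U S (N2 + N1).
Proof.
move=> UT TS s sW sN u uU; rewrite -(cat_take_drop N2 s) act_cat.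
have sN2 : (N2 <= size s)%N by apply: leq_trans sN; apply: leq_addr.
apply: TS => [f /mem_take /sW //||]; first by rewrite size_takel.
apply: UT => // [f /mem_drop /sW //|].
by rewrite size_drop leq_subRL.
Qed.

(** A Nakayama argument: substituting the inclusion into itself puts [U] inside [T] plus images of
    longer and longer words, which end in [T]. *)
Lemma words_map_proper s U T N : words_map (fun f => f \in s) U T N ->
  (forall f, f \in s -> forall u, u \in T -> f u \in T) ->
  (U <= T + \sum_(f <- s) f @: U)%VS -> (U <= T)%VS.
Proof.
move=> UT sT Us; elim: N UT => [|N IH] UT.
  by apply/subvP => u uU; apply: (UT [::]).
apply: IH => w ws wN u uU; have /memv_addP[t tT [v vs ->]] := subvP Us u uU.
rewrite linearD memvD //=; first exact: act_stable sT ws _ tT.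
have: (\sum_(f <- s) f @: U <= linfun (act w) @^-1: T)%VS.
  rewrite big_seq; apply: (big_ind (fun X => (X <= _)%VS)) => [|X Y|f fs].
  - exact: sub0v.
  - by move=> *; rewrite subv_add; apply/andP.
  apply/subvP => _ /memv_imgP[x xU ->]; rewrite -memv_preim lfunE /=.
  rewrite -[act w (f x)]/(act w (act [:: f] x)) -act_cat.
  apply: UT => [g||//]; last by rewrite size_cat addn1.
  by rewrite mem_cat inE => /orP[/ws | /eqP ->].
by move/subvP/(_ v vs); rewrite -memv_preim lfunE.
Qed.

(* Jacobson's theorem on weakly closed sets of nilpotent operators, on U/T.   *)
(* A subspace S' strictly between T and U whose stabiliser spans as much as   *)
(* possible has to be stable under W: starting from an operator f in W which  *)
(* does not stabilise S', commutation with the stabiliser produces operators  *)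
(* outside its span that map U into T and hence stabilise S'.                 *)
Theorem weakly_closed_nilpotent W U T :
    weakly_closed W -> stable W U -> stable W T -> (T <= U)%VS ->
    (forall f, W f -> exists n, forall u, u \in U -> iter n f u \in T) ->
  exists N, words_map W U T N.
Proof.
have [k] := ubnP (\dim U - \dim T); elim: k W U T => // k IH W U T lk.
move=> Wc WU WT TU Wnil.
have [WUT|] := classic (forall f, W f -> forall u, u \in U -> f u \in T).
  exists 1%N => -[|f s] // sW _ u uU /=; apply: (WUT f); first exact/sW/mem_head.
  by apply: (act_stable WU) uU => g gs; apply: sW; rewrite inE gs orbT.
move=> /not_maps_into[w [u0 [Ww u0U wu0]]].
(* An intermediate stable subspace reduces the claim to the smaller quotients U/S and S/T. *)
have split_at S (C : 'End(V) -> Prop) :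
    (forall f, C f -> W f) -> weakly_closed C -> stable C S -> (T <= S)%VS ->
    (S <= U)%VS -> S <> T -> S <> U -> exists N, words_map C U T N.
  move=> CW Cc CS TS SU ST SU'.
  have dTS : (\dim T < \dim S)%N.
    rewrite ltn_neqAle dimvS // andbT; apply/eqP => /eqP.
    by rewrite (dimv_leqif_eq TS) => /eqP/esym.
  have dSU : (\dim S < \dim U)%N.
    rewrite ltn_neqAle dimvS // andbT; apply/eqP => /eqP.
    by rewrite (dimv_leqif_eq SU) => /eqP.
  have [||f Cf u uU|f Cf u uT|||N1 N1P] := IH C U S => //.
  - by rewrite -ltnS (leq_trans _ lk) // ltnS ltn_sub2l // (ltn_trans dTS).
  - by apply: WU uU; apply: CW.
  - exact: CS uT.
  - move=> f /CW/Wnil[n fn]; exists n => u uU; exact: subvP TS _ (fn u uU).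
  have [||f Cf u uU|f Cf u uT|||N2 N2P] := IH C S T => //.
  - by rewrite -ltnS (leq_trans _ lk) // ltnS ltn_sub2r // (ltn_trans dTS).
  - exact: CS uU.
  - by apply: WT uT; apply: CW.
  - by move=> f /CW/Wnil[n fn]; exists n => u uS; apply: fn; exact: subvP SU _ uS.
  by exists (N2 + N1)%N; exact: words_map_trans N1P N2P.
(* For the maximal list [s] found below, [img s] is the subspace S' announced above. *)
pose img s := (T + \sum_(f <- s) f @: U)%VS.
have imgP s f u : f \in s -> u \in U -> f u \in img s.
  move=> fs uU; apply: (subvP (addvSr _ _)).
  by rewrite (big_rem f fs) /=; apply: (subvP (addvSl _ _)); exact: memv_img.
have img_sub s : (forall f, f \in s -> W f) -> (img s <= U)%VS.
  move=> sW; rewrite subv_add TU /= big_seq.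
  apply: (big_ind (fun X => (X <= U)%VS)) => [|X Y XU YU|f fs]; first exact: sub0v.
    by rewrite subv_add XU.
  by apply/subvP => _ /memv_imgP[u uU ->]; exact: WU (sW f fs) _ uU.
pose moves s := exists f u, [/\ f \in s, u \in U & f u \notin T].
have img_proper s N : (forall f, f \in s -> W f) -> moves s ->
    words_map (fun f => f \in s) U T N -> img s <> T /\ img s <> U.
  move=> sW [f [u [fs uU fuT]]] sN; split=> e.
    by case/negP: fuT; rewrite -e; exact: imgP.
  have UT : (U <= T)%VS.
    apply: (words_map_proper sN) => [g gs v vT|]; first exact: WT (sW g gs) _ vT.
    by rewrite -[X in (X <= _)%VS]e.
  by case/negP: fuT; apply: (subvP UT); exact: WU (sW f fs) _ uU.
pose good (p : {vspace V} * seq 'End(V)) := let: (X, s) := p in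
  [/\ [/\ (T <= X)%VS, (X <= U)%VS, X <> T & X <> U], forall f, f \in s -> W f,
      forall f, f \in s -> forall u, u \in X -> f u \in X & moves s].
have good_img s N : (forall f, f \in s -> W f) -> moves s ->
    words_map (fun f => f \in s) U T N -> good (img s, s).
  move=> sW sm sN; have [? ?] := img_proper s N sW sm sN.
  split=> //; first by split=> //; [exact: addvSl | exact: img_sub].
  by move=> f fs u us; apply: imgP => //; exact: subvP (img_sub s sW) _ us.
(* A single non-trivial operator is enough to start: the words in [w] are its powers. *)
have [p0 p0P] : exists p, good p.
  have [n wn] := Wnil w Ww; exists (img [:: w], [:: w]); apply: (good_img _ n).
  - by move=> f; rewrite inE => /eqP ->.
  - by exists w, u0; rewrite mem_head.
  move=> s sw sn u uU; have -> : s = nseq (size s) w.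
    by apply/all_pred1P/allP => f /sw; rewrite inE.
  have E j v : act (nseq j w) v = iter j w v by elim: j => //= j ->.
  rewrite E -(subnK sn) iterD; elim: (_ - _)%N => [|j IHj]; first exact: wn.
  exact: WT.
have [|[S s] [[TS SU ST SU'] sW sS sm] smax] :=
  @exists_maximal _ good (fun p => \dim <<p.2>>%VS) (\dim {:'End(V)}) _ p0 p0P.
  by move=> p _; apply: dimvS; exact: subvf.
(* The members of [W] stabilising [S] form a weakly closed set containing [s], to which [split_at]
   applies. *)
have [N sN] : exists N, words_map (fun f => f \in s) U T N.
  pose C f := W f /\ forall u, u \in S -> f u \in S.
  have Cc : weakly_closed C.
    move=> f g [Wf fS] [Wg gS]; have [c Wfg] := Wc f g Wf Wg.
    exists c; split=> // u uS.
    by rewrite add_lfunE scale_lfunE !comp_lfunE memvD ?memvZ //;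
      [apply/fS/gS | apply/gS/fS].
  have [||N NP] := split_at S C _ Cc _ TS SU ST SU'; try by move=> f [].
  by exists N => t ts; apply: NP => f /ts fs; split; [exact: sW | exact: sS].
have sg := good_img s N sW sm sN.
have span_img f u : f \in <<s>>%VS -> u \in U -> f u \in img s.
  move=> fs uU; rewrite (@coord_span _ _ _ (in_tuple s) f fs) sum_lfunE.
  by rewrite memv_suml // => i _; rewrite scale_lfunE memvZ // imgP // mem_nth.
(* Otherwise adjoining [f] to [s] would give a good pair with a larger span. *)
have stab_span f : W f -> (forall u, u \in img s -> f u \in img s) -> f \in <<s>>%VS.
  move=> Wf fS; have := smax (img s, f :: s); case: sg => sg1 _ sg3 _.
  have /[swap]/[apply]/= : good (img s, f :: s).
    split=> // [g|g|]; rewrite ?inE; first by case/orP=> [/eqP -> | /sW].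
      by case/orP=> [/eqP -> | /sg3].
    by have [g [u [gs uU gu]]] := sm; exists g, u; rewrite inE gs orbT.
  have sub : (<<s>> <= <<f :: s>>)%VS by rewrite span_cons addvSr.
  rewrite (geq_leqif (dimv_leqif_sup sub)) span_cons => le.
  by apply: (subvP le); apply: (subvP (addvSl _ _)); exact: memv_line.
have [[TS' SU2 ST' SU2'] _ _ _] := sg.
have [WS|] := classic (stable W (img s)); first by apply: (split_at (img s)).
move=> /not_maps_into[f0 [v0 [Wf0 v0S f0v0]]].
(* At [j = N + N] both words may be empty, so [f] itself maps [U] into [T]. *)
pose level j (f : 'End(V)) := forall s1 s2, (forall g, g \in s1 -> g \in s) ->
  (forall g, g \in s2 -> g \in s) -> (N + N <= size s1 + size s2 + j)%N ->
  forall u, u \in U -> act s1 (f (act s2 u)) \in T.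
have sU : stable (fun g => g \in s) U by move=> g /sW; exact: WU.
have sT : stable (fun g => g \in s) T by move=> g /sW; exact: WT.
have descent j : exists f, [/\ W f, f \notin <<s>>%VS & level j f].
  elim: j => [|j [f [Wf fs fj]]].
    exists f0; split=> //.
      by apply: contra f0v0 => /span_img -> //; exact: subvP SU2 _ v0S.
    move=> s1 s2 s1s s2s; rewrite addn0 => sz u uU.
    (* With at least [N + N] letters around [f], one of the two sides has [N] of them. *)
    have [le|lt] := leqP N (size s1).
      by apply: sN => //; apply: WU => //; exact: act_stable sU _ _ uU.
    apply: (act_stable sT) => //; apply: WT => //; apply: sN => //.
    by rewrite -(leq_add2l N) (leq_trans sz) // leq_add2r ltnW.
  have [[b [c [bs Wg gs]]]|no] := classic (exists b c,
      [/\ b \in s, W ((f \o b)%VF + c *: (b \o f)%VF)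
        & (f \o b)%VF + c *: (b \o f)%VF \notin <<s>>%VS]).
    exists ((f \o b)%VF + c *: (b \o f)%VF); split=> // s1 s2 s1s s2s sz u uU.
    rewrite add_lfunE scale_lfunE !comp_lfunE linearD linearZ memvD ?memvZ //=.
      apply: (fj s1 (b :: s2)) => // [g|]; last by rewrite /= addnS addSnnS.
      by rewrite inE => /orP[/eqP -> // | /s2s].
    rewrite -[act s1 _]/(act s1 (act [:: b] _)) -act_cat.
    apply: fj => // [g|]; last by rewrite size_cat /= addn1 !addSn -addnS.
    by rewrite mem_cat inE => /orP[/s1s // | /eqP ->].
  (* If all these weak commutators lie in the span, then f(b u) is such a commutator at u minus c
     b(f u), and both terms lie in [img s]: so [f] stabilises [img s]. *)
  case/negP: fs; apply: stab_span => // v /memv_addP[t tT [x xs ->]].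
  rewrite linearD memvD //=; first by apply: (subvP TS'); exact: WT.
  have : (\sum_(b <- s) b @: U <= f @^-1: img s)%VS.
    rewrite big_seq; apply: (big_ind (fun X => (X <= _)%VS)) => [|X Y XI YI|b bs].
    - exact: sub0v.
    - by rewrite subv_add XI.
    apply/subvP => _ /memv_imgP[u uU ->]; rewrite -memv_preim.
    have [c Wg] := Wc f b Wf (sW b bs).
    have gs : (f \o b)%VF + c *: (b \o f)%VF \in <<s>>%VS.
      by apply/negPn/negP => gs; apply: no; exists b, c.
    have := span_img _ _ gs uU; rewrite add_lfunE scale_lfunE !comp_lfunE.
    by rewrite rpredDr // memvZ // imgP // WU.
  by move/subvP/(_ x xs); rewrite -memv_preim.
have [f [Wf /negP fs fN]] := descent (N + N)%N.
case: fs; apply: stab_span => // u us.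
by apply: (subvP TS'); apply: (fN [::] [::]) => //; exact: subvP SU2 _ us.
Qed.

End WeaklyClosed.

(** * Linearised alternative laws *)

Section Linearization.
Variables (V : zmodType) (op : V -> V -> V).
Hypothesis opDl : forall v, {morph op^~ v : u1 u2 / u1 + u2}.
Hypothesis opDr : forall u, {morph op u : v1 v2 / v1 + v2}.

Lemma associatorDl y z : {morph (associator op)^~ y ^~ z : x1 x2 / x1 + x2}.
Proof. by move=> x1 x2; rewrite /associator !opDl opprD addrACA. Qed.

Lemma associatorDm x z : {morph (associator op x)^~ z : y1 y2 / y1 + y2}.
Proof. by move=> y1 y2; rewrite /associator opDr !opDl opDr opprD addrACA. Qed.

Lemma associatorDr x y : {morph associator op x y : z1 z2 / z1 + z2}.
Proof. by move=> z1 z2; rewrite /associator !opDr opprD addrACA. Qed.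

Lemma alternative_on_linearized (D : V -> Prop) :
    alternative_on op D -> (forall x y, D x -> D y -> D (x + y)) ->
  forall x y z, D x -> D y -> D z ->
  associator op x y z + associator op y x z = 0 /\
  associator op x y z + associator op x z y = 0.
Proof.
move=> alt DD x y z Dx Dy Dz; split.
  have [+ _] := alt _ _ (DD _ _ Dx Dy) Dz.
  by rewrite associatorDl !associatorDm !(proj1 (alt _ _ _ _)) // addr0 add0r.
have [_] := alt _ _ Dx (DD _ _ Dy Dz).
by rewrite associatorDr !associatorDm !(proj2 (alt _ _ _ _)) // addr0 add0r addrC.
Qed.

End Linearization.

(** * Superidentities read off from the Grassmann envelope *)

Section Envelope.
Variables (F : fieldType) (A : vectType F) (mul : {bilinear A -> A -> A}).
Variable A_ : bool -> {vspace A}.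
Local Notation assoc := (associator mul).
Local Notation gmul := (grass_mul mul).

Let mulDl v : {morph mul^~ v : u1 u2 / u1 + u2}. Proof. exact: linearDl. Qed.
Let mulDr u : {morph mul u : v1 v2 / v1 + v2}. Proof. exact: linearDr. Qed.

Lemma grass_associatorU (S T X : {fset nat}) x y z :
    [disjoint S & T]%fset -> [disjoint S & X]%fset -> [disjoint T & X]%fset ->
  associator gmul << x *g S >> << y *g T >> << z *g X >> =
  << (-1) ^+ (inversions S T + inversions S X + inversions T X) *:
       assoc x y z *g (S `|` T `|` X)%fset >>.
Proof.
move=> dST dSX dTX; rewrite /associator !grass_mulUU //.
rewrite /grass_monom_mul dST dTX !grass_mulUU // /grass_monom_mul.
rewrite fdisjointUX fdisjointXU dST dSX dTX /= inversionsUl // inversionsUr //.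
rewrite linearZl_LR linearZr_LR /= !scalerA -!exprD fsetUA -monalgUB.
rewrite scalerBr; congr << _ *: _ - _ *: _ *g _ >>; congr (_ ^+ _).
by rewrite addnC ?addnA // addnAC.
Qed.

Let monalgU_eq0 (S : {fset nat}) x :
  << x *g S >> = 0 :> {malg A[{fset nat}]} -> x = 0.
Proof. by move/(congr1 (mcoeff S)); rewrite mcoeffUU mcoeff0. Qed.

(** Indexes the simplest Grassmann monomial of parity [p]: the generator e_n or 1. *)
Definition gen_or_one (p : bool) (n : nat) : {fset nat} :=
  if p then [fset n]%fset else fset0.

Lemma inversions_gen_or_one p q m n :
  inversions (gen_or_one p m) (gen_or_one q n) = (p * q * (n < m))%N.
Proof.
rewrite /inversions; case: p => /=; last by rewrite big_seq_fset0.
rewrite big_seq_fset1; case: q => /=; last by rewrite big_seq_fset0.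
by rewrite big_seq_fset1 !mul1n.
Qed.

Lemma disjoint_gen_or_one p q m n : (m != n) || ~~ (p && q) ->
  [disjoint gen_or_one p m & gen_or_one q n]%fset.
Proof.
case: p q => [] [] /=; rewrite ?fdisjoint0X ?fdisjointX0 // orbF => mn.
by rewrite fdisjoint1X in_fset1.
Qed.

Lemma envelope_gen_or_one p n x : x \in A_ p ->
  grassmann_envelope A_ << x *g gen_or_one p n >>.
Proof.
move=> xA S; rewrite mcoeffU; case: eqP => [<-|_]; last exact: mem0v.
by rewrite mulr1n /gen_or_one; case: p xA; rewrite ?cardfs1 ?cardfs0.
Qed.

Hypothesis altA : alternative_superalgebra mul A_.

Let linearized f g h :
    grassmann_envelope A_ f -> grassmann_envelope A_ g -> grassmann_envelope A_ h ->
  associator gmul f g h + associator gmul g f h = 0 /\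
  associator gmul f g h + associator gmul f h g = 0.
Proof.
apply: (alternative_on_linearized _ _ (proj2 altA)).
- exact: grass_mulDl.
- exact: grass_mulDr.
- by move=> f1 f2 f1A f2A S; rewrite mcoeffD memvD.
Qed.

(** Attach distinct generators to the odd arguments. The linearised law then has both terms on one
    monomial, and sorting the generators after the swap of [x] and [y] costs the sign. *)
Lemma left_superalternative i j k x y z :
  x \in A_ i -> y \in A_ j -> z \in A_ k ->
  assoc x y z = - ((-1) ^+ (i * j)%N *: assoc y x z).
Proof.
move=> xi yj zk.
have [+ _] :=
  linearized (envelope_gen_or_one 0 xi) (envelope_gen_or_one 1 yj)
    (envelope_gen_or_one 2 zk).
rewrite !grass_associatorU ?disjoint_gen_or_one // !inversions_gen_or_one /=.
rewrite !muln0 !addn0 muln1.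
rewrite expr0 scale1r [(gen_or_one j 1 `|` _)%fset]fsetUC -monalgUD mulnC.
by move/monalgU_eq0/eqP; rewrite addr_eq0 => /eqP.
Qed.

Lemma right_superalternative i j k x y z :
  x \in A_ i -> y \in A_ j -> z \in A_ k ->
  assoc x y z = - ((-1) ^+ (j * k)%N *: assoc x z y).
Proof.
move=> xi yj zk.
have [_] :=
  linearized (envelope_gen_or_one 0 xi) (envelope_gen_or_one 1 yj)
    (envelope_gen_or_one 2 zk).
rewrite !grass_associatorU ?disjoint_gen_or_one // !inversions_gen_or_one /=.
rewrite !muln0 !addn0 muln1.
rewrite expr0 scale1r fsetUAC -monalgUD [(k * j)%N]mulnC.
by move/monalgU_eq0/eqP; rewrite addr_eq0 => /eqP.
Qed.

(** An even [a] is tensored with 1, which may be repeated, so the quadratic law itself is read off;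
    this also covers characteristic 2. *)
Lemma even_alternative k a z : a \in A_ false -> z \in A_ k ->
  assoc a a z = 0 /\ assoc z a a = 0.
Proof.
move=> a0 zk; have ea := envelope_gen_or_one 0 a0; have ez := envelope_gen_or_one 1 zk.
have [h1 _] := proj2 altA _ _ ea ez; have [_ h2] := proj2 altA _ _ ez ea.
split; [move: h1 | move: h2]; rewrite grass_associatorU ?disjoint_gen_or_one //.
  by rewrite !inversions_gen_or_one /= expr0 scale1r => /monalgU_eq0.
by rewrite !inversions_gen_or_one /= !muln0 expr0 scale1r => /monalgU_eq0.
Qed.

End Envelope.

(** * Multiplication operators and their nilpotency *)

Section Nilpotency.
Variables (F : fieldType) (A : vectType F) (mul : {bilinear A -> A -> A}).
Variable A_ : bool -> {vspace A}.
Hypothesis altA : alternative_superalgebra mul A_.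
Implicit Types (a b c u v x : A) (T U : {vspace A}) (f : 'End(A)).

Let superA : superalgebra mul A_ := proj1 altA.

Lemma mul_homogeneous i j a b : a \in A_ i -> b \in A_ j -> mul a b \in A_ (i (+) j).
Proof. by case: superA => _ _; apply. Qed.

Lemma homogeneous_decomposition v :
  exists v0 v1, [/\ v0 \in A_ false, v1 \in A_ true & v = v0 + v1].
Proof.
case: superA => _ full _; have : v \in (A_ false + A_ true)%VS by rewrite full memvf.
by case/memv_addP => v0 v0A [v1 v1A ->]; exists v0, v1.
Qed.

Lemma homogeneous_ext (f g : 'End(A)) :
  (forall k v, v \in A_ k -> f v = g v) -> f = g.
Proof.
move=> fg; apply/lfunP => v.
have [v0 [v1 [/fg e0 /fg e1 ->]]] := homogeneous_decomposition v.
by rewrite !linearD /= e0 e1.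
Qed.

(** Unlike [Rop], this carries no sign. *)
Definition rmul a : 'End(A) := linfun (applyr mul a).

Lemma rmulE a v : rmul a v = mul v a.
Proof. exact: (lfunE (applyr mul a)). Qed.

Definition right_ops f := exists a, homogeneous A_ a /\ f = rmul a.
Definition left_ops f := exists a, homogeneous A_ a /\ f = Lop mul a.

Let eq_sub_oppZ (e : F) x y u v :
  x - y = - (e *: (u - v)) -> x + e *: u = y + e *: v.
Proof. by move=> E; apply/eqP; rewrite -subr_eq0 opprD addrACA E -scalerBr addNr. Qed.

(** The superidentity for (v,b,a) and (v,a,b) rearranges to (vb)a + e(va)b = v(ba + e ab), where e
    is the sign of the swap. *)
Lemma right_ops_weakly_closed : weakly_closed right_ops.
Proof.
move=> _ _ [a [[i ai] ->]] [b [[j bj] ->]]; exists ((-1) ^+ (j * i)%N).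
exists (mul b a + (-1) ^+ (j * i)%N *: mul a b); split.
  exists (i (+) j); apply: memvD; first by rewrite addbC; exact: mul_homogeneous.
  by apply/memvZ/mul_homogeneous.
apply: homogeneous_ext => k v vk; have := right_superalternative altA vk bj ai.
rewrite add_lfunE scale_lfunE !comp_lfunE !rmulE linearDr linearZr_LR /associator.
exact: eq_sub_oppZ.
Qed.

Lemma left_ops_weakly_closed : weakly_closed left_ops.
Proof.
move=> _ _ [a [[i ai] ->]] [b [[j bj] ->]]; exists ((-1) ^+ (i * j)%N).
exists (mul a b + (-1) ^+ (i * j)%N *: mul b a); split.
  exists (i (+) j); apply: memvD; first exact: mul_homogeneous.
  by rewrite addbC; apply/memvZ/mul_homogeneous.
apply: homogeneous_ext => k v vk; have := left_superalternative altA ai bj vk.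
rewrite add_lfunE scale_lfunE !comp_lfunE !LopE linearDl linearZl_LR /associator.
by move/eq_sub_oppZ.
Qed.

Lemma iter_lfunD n f u v : iter n f (u + v) = iter n f u + iter n f v.
Proof. by elim: n => //= n ->; rewrite linearD. Qed.

(** On a homogeneous vector the iterates of [Rop] and [rmul] differ only by a sign. *)
Lemma rmul_nilpotent a : homogeneous A_ a -> nilpotent_operator (Rop mul A_ a) ->
  exists n, forall v, iter n (rmul a) v = 0.
Proof.
move=> [i ai] [n Rn]; exists n => v.
suff hom j u : u \in A_ j -> iter n (rmul a) u = 0.
  have [v0 [v1 [/hom e0 /hom e1 ->]]] := homogeneous_decomposition v.
  by rewrite iter_lfunD e0 e1 addr0.
move=> uj; have [k [e [_ ue]]] : exists k e, iter n (rmul a) u \in A_ k /\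
    iter n (Rop mul A_ a) u = (-1) ^+ e *: iter n (rmul a) u.
  elim: (n) => [|m [k [e [uk ue]]]]; first by exists j, 0%N; rewrite scale1r.
  exists (k (+) i), (e + i * k)%N; rewrite !iterS rmulE.
  split; first exact: mul_homogeneous.
  by rewrite ue linearZ /= (RopE superA ai uk) scalerA exprD.
by apply/eqP; move/eqP: (Rn u); rewrite ue scaler_eq0 signr_eq0.
Qed.

Lemma iter_even b n v : b \in A_ false ->
  let bn := iter n (fun x => mul x x) b in
  iter (2 ^ n) (Lop mul b) v = mul bn v /\ iter (2 ^ n) (rmul b) v = mul v bn.
Proof.
move=> b0 /=; have bn0 m : iter m (fun x => mul x x) b \in A_ false.
  by elim: m => //= m IH; exact: (mul_homogeneous IH IH).
elim: n v => [|n IH] v; first by rewrite /= LopE rmulE.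
rewrite expnS mul2n -addnn !iterD !(proj1 (IH _)) !(proj2 (IH _)) iterS.
set c := iter n _ b; have c0 : c \in A_ false := bn0 n.
have [v0 [v1 [v0A v1A ->]]] := homogeneous_decomposition v.
have [/eqP l0 /eqP r0] := even_alternative altA c0 v0A.
have [/eqP l1 /eqP r1] := even_alternative altA c0 v1A.
rewrite !(linearDr, linearDl) /=.
move: l0 r0 l1 r1; rewrite /associator !subr_eq0 => /eqP -> /eqP -> /eqP -> /eqP ->.
by [].
Qed.

(** Let c be [b] squared n times. Then cc is the power [2 ^ n] of right multiplication by [b]
    applied to c, which is zero since [2 ^ n] exceeds [n]; and left multiplication by cc is a power
    of that by [b]. *)
Lemma Lop_even_nilpotent b : b \in A_ false ->
  (exists n, forall v, iter n (rmul b) v = 0) ->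
  exists n, forall v, iter n (Lop mul b) v = 0.
Proof.
move=> b0 [n bn]; exists (2 ^ n.+1)%N => v.
have [-> _] := iter_even n.+1 v b0; rewrite iterS.
set c := iter n _ b; have [_ <-] := iter_even n c b0.
by rewrite -(subnKC (ltnW (ltn_expl n (ltnSn 1)))) iterD bn linear0l.
Qed.

(** Moving [v] past two copies of [a] gives (a,a,v) = (v,a,a), as the sign of each swap occurs
    twice. *)
Lemma odd_associator a v : a \in A_ true ->
  mul a (mul a v) = mul (mul a a) v + mul v (mul a a) - mul (mul v a) a.
Proof.
move=> a1; have hom k u : u \in A_ k -> associator mul a a u = associator mul u a a.
  move=> uk; rewrite (right_superalternative altA a1 a1 uk).
  rewrite (left_superalternative altA a1 uk a1) scalerN opprK scalerA -exprD addnn.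
  by rewrite -mul2n exprM sqrrN !expr1n scale1r.
have e : associator mul a a v = associator mul v a a.
  have [v0 [v1 [/hom e0 /hom e1 ->]]] := homogeneous_decomposition v.
  by rewrite associatorDr ?associatorDl ?e0 ?e1 // => ? ? ?; rewrite ?linearDl ?linearDr.
by rewrite -[LHS](subKr (mul (mul a a) v)) -/(associator mul a a _) e opprB addrA.
Qed.

Definition two_sided T := (forall a v, v \in T -> mul a v \in T) /\
  (forall a v, v \in T -> mul v a \in T).

(* If U A <= T, then l_a^2 and l_(a^2) agree on U modulo T for a odd.         *)
Lemma Lop_nilpotent_mod U T a : two_sided U -> two_sided T ->
    (forall u b, u \in U -> mul u b \in T) -> homogeneous A_ a ->
    (forall b, homogeneous A_ b -> exists n, forall v, iter n (rmul b) v = 0) ->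
  exists n, forall u, u \in U -> iter n (Lop mul a) u \in T.
Proof.
move=> [lU rU] [lT _] UT [[] ai] rnil; last first.
  have [n an] := Lop_even_nilpotent ai (rnil a (ex_intro _ false ai)).
  by exists n => u _; rewrite an mem0v.
have b0 : mul a a \in A_ false := mul_homogeneous ai ai.
have [n bn] := Lop_even_nilpotent b0 (rnil _ (ex_intro _ false b0)).
have sU c m u : u \in U -> iter m (Lop mul c) u \in U.
  by elim: m => //= m IH uU; rewrite LopE; apply/lU/IH.
(* The induction compares 2m factors [a] with m factors [mul a a] modulo [T]; the latter product
   vanishes at m = n. *)
exists n.*2 => u uU; rewrite -[iter _ _ u]subr0 -(bn u).
elim: (n) => [|m IH]; first by rewrite subrr mem0v.
rewrite doubleS !iterS !LopE.
set x := iter m.*2 _ u in IH *; set y := iter m _ u in IH *.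
have xU : x \in U by exact: sU.
have -> : mul a (mul a x) - mul (mul a a) y =
    mul (mul a a) (x - y) + (mul x (mul a a) - mul (mul x a) a).
  rewrite (odd_associator x ai) linearBr addrA [LHS]addrAC.
  by congr (_ - _); rewrite addrAC.
by rewrite memvD ?lT // memvB ?UT // rU.
Qed.

(** * The chain of right annihilators *)

Definition graded T := forall v0 v1, v0 \in A_ false -> v1 \in A_ true ->
  v0 + v1 \in T -> v0 \in T /\ v1 \in T.

(** Intersecting over a basis presents {v | v A <= T} as a subspace. *)
Definition rann_mod T : {vspace A} :=
  (\bigcap_(a <- vbasis {:A}) (rmul a @^-1: T))%VS.

Lemma rann_modP T v : reflect (forall a, mul v a \in T) (v \in rann_mod T).
Proof.
apply: (iffP idP) => [|vT]; last first.
  rewrite /rann_mod; apply: (big_ind (fun X : {vspace A} => v \in X)) => [|X Y|a _].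
  - exact: memvf.
  - by rewrite memv_cap => -> ->.
  - by rewrite -memv_preim rmulE.
rewrite /rann_mod => vT a; have sub : (<<vbasis {:A}>> <= Lop mul v @^-1: T)%VS.
  apply/span_subvP => b bB; rewrite -memv_preim LopE.
  by move: vT; rewrite (big_rem b bB) memv_cap -memv_preim rmulE => /andP[].
rewrite -LopE memv_preim; apply: (subvP sub).
by rewrite (span_basis (vbasisP _)) memvf.
Qed.

Lemma rann_mod_graded T : graded T -> graded (rann_mod T).
Proof.
move=> gT v0 v1 v0A v1A /rann_modP vT; suff vaT a : mul v0 a \in T /\ mul v1 a \in T.
  by split; apply/rann_modP => a; case: (vaT a).
have [a0 [a1 [a0A a1A ->]]] := homogeneous_decomposition a.
have [] := gT (mul v0 a0) (mul v1 a0)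
  (mul_homogeneous v0A a0A) (mul_homogeneous v1A a0A).
  by rewrite -linearDl.
have [] := gT (mul v1 a1) (mul v0 a1)
  (mul_homogeneous v1A a1A) (mul_homogeneous v0A a1A).
  by rewrite addrC -linearDl.
by move=> ? ? ? ?; rewrite !linearDr !memvD.
Qed.

Lemma sub_rann_mod T : two_sided T -> (T <= rann_mod T)%VS.
Proof. by move=> [_ rT]; apply/subvP => v vT; apply/rann_modP => a; apply: rT. Qed.

(** For the left ideal property write (bu)c = (b,u,c) + b(uc) and exchange [b] and [u] in the
    associator: every term then contains a product of [u] with something on its right. Gradedness
    allows this to be done on homogeneous components. *)
Lemma rann_mod_two_sided T : graded T -> two_sided T -> two_sided (rann_mod T).
Proof.
move=> gT sT; have [lT rT] := sT; split=> [a v vT|a v /rann_modP vT]; last first.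
  by apply: (subvP (sub_rann_mod sT)).
have hom i j k b c u : b \in A_ i -> u \in A_ j -> c \in A_ k -> u \in rann_mod T ->
    mul (mul b u) c \in T.
  move=> bi uj ck /rann_modP uT; rewrite -[mul (mul b u) c](subrK (mul b (mul u c))).
  apply: memvD; last exact/lT/uT.
  rewrite -[_ - _]/(associator mul b u c) (left_superalternative altA bi uj ck).
  by rewrite memvN memvZ // memvB //; exact/rT/uT.
apply/rann_modP => c; move: vT.
have [v0 [v1 [v0A v1A ->]]] := homogeneous_decomposition v.
move=> /(rann_mod_graded gT v0A v1A)[v0T v1T].
have [a0 [a1 [a0A a1A ->]]] := homogeneous_decomposition a.
have [c0 [c1 [c0A c1A ->]]] := homogeneous_decomposition c.
by rewrite !(linearDl, linearDr) /= !memvD //; apply: hom; eassumption.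
Qed.

Definition right_annihilators n := iter n rann_mod 0%VS.

Lemma right_annihilators_ideal n :
  graded (right_annihilators n) /\ two_sided (right_annihilators n).
Proof.
elim: n => [|n [gT sT]]; last first.
  by split; [exact: rann_mod_graded | exact: rann_mod_two_sided].
split=> [v0 v1 v0A v1A|]; last first.
  by split=> a v; rewrite !memv0 => /eqP ->; rewrite ?linear0l ?linear0r.
case: superA => /directv_addP dA _ _; rewrite !memv0 => /eqP e.
have : v0 \in (A_ false :&: A_ true)%VS.
  by rewrite memv_cap v0A (_ : v0 = - v1) ?memvN //; apply/eqP; rewrite -addr_eq0 e.
by rewrite dA memv0 => /eqP v00; move: e; rewrite v00 add0r => ->.
Qed.

Lemma mem_right_annihilators n v :
  (forall s, (forall f, f \in s -> right_ops f) -> size s = n -> act s v = 0) ->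
  v \in right_annihilators n.
Proof.
elim: n v => [|n IH] v vn; first by rewrite memv0 [v](vn [::]).
apply/rann_modP => a; have [a0 [a1 [a0A a1A ->]]] := homogeneous_decomposition a.
have hom i b : b \in A_ i -> mul v b \in right_annihilators n.
  move=> bi; apply: IH => s sr sn; rewrite -rmulE.
  rewrite -[act s _]/(act s (act [:: rmul b] v)) -act_cat vn // => [f|].
    by rewrite mem_cat inE => /orP[/sr // | /eqP ->]; exists b; split=> //; exists i.
  by rewrite size_cat addn1 sn.
by rewrite linearDr memvD // (hom _ _ a0A, hom _ _ a1A).
Qed.

(** * From nilpotent right multiplications to a nilpotent algebra *)

Hypothesis rnil : forall a, homogeneous A_ a ->
  exists n, forall v, iter n (rmul a) v = 0.

Lemma right_annihilators_full : exists n, right_annihilators n = {:A}%VS.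
Proof.
have [|||||n nP] := @weakly_closed_nilpotent _ _ right_ops fullv 0%VS.
- exact: right_ops_weakly_closed.
- by move=> *; exact: memvf.
- by move=> f _ u; rewrite !memv0 => /eqP ->; rewrite linear0.
- exact: subvf.
- by move=> _ [a [/rnil[n an] ->]]; exists n => u _; rewrite an mem0v.
exists n; apply/vspaceP => v; rewrite memvf.
apply: mem_right_annihilators => s sr sn.
by apply/eqP; rewrite -memv0; apply: nP; rewrite ?sn ?memvf.
Qed.

Definition mult_ops f := left_ops f \/ right_ops f.

Lemma mult_ops_stable T : two_sided T -> stable mult_ops T.
Proof.
move=> [lT rT] _ [] [a [_ ->]] v vT; first by rewrite LopE lT.
by rewrite rmulE rT.
Qed.

Lemma words_map_right_annihilators n :
  exists N, words_map mult_ops (right_annihilators n) 0%VS N.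
Proof.
elim: n => [|n [N NP]].
  by exists 0%N => s _ _ u; rewrite !memv0 => /eqP ->; rewrite linear0.
have [gT sT] := right_annihilators_ideal n.
have [_ sU] := right_annihilators_ideal n.+1.
set T := right_annihilators n in NP gT sT; set U := right_annihilators n.+1 in sU *.
have UT u b : u \in U -> mul u b \in T by move/rann_modP; apply.
have [|||||M MP] := @weakly_closed_nilpotent _ _ left_ops U T.
- exact: left_ops_weakly_closed.
- by move=> f lf; apply: (mult_ops_stable sU); left.
- by move=> f lf; apply: (mult_ops_stable sT); left.
- exact: sub_rann_mod.
- by move=> _ [a [ha ->]]; exact: Lop_nilpotent_mod.
suff M' : words_map mult_ops U T M by exists (N + M)%N; exact: words_map_trans M' NP.
move=> s sW sM u uU.
(* A single right multiplication already sends [U] into [T], and all other letters preserve both; a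
   word without one consists of left multiplications. *)
have [[f fs [a [ha fa]]]|noR] := classic (exists2 f, f \in s & right_ops f).
  move: sW; case/splitPr: s / fs sM => s1 s2 _ sW.
  rewrite act_cat /=; apply: (act_stable (mult_ops_stable sT)) => [g gs|].
    by apply: sW; rewrite mem_cat gs.
  rewrite fa rmulE UT //; apply: (act_stable (mult_ops_stable sU)) => // g gs.
  by apply: sW; rewrite mem_cat inE gs !orbT.
by apply: MP => // f fs; case: (sW f fs) => // rf; case: noR; exists f.
Qed.

Theorem nilpotent_of_rmul_nilpotent : nilpotent_algebra mul.
Proof.
have [n nfull] := right_annihilators_full.
have [N] := words_map_right_annihilators n; rewrite nfull => NP.
exists (2 ^ N)%N; first by rewrite expn_gt0.
(* The word [s] holds the multiplications already peeled off and [k] counts those still available: a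
   factor with at least half of the entries stays, and the other one, split into homogeneous parts,
   joins [s]. *)
suff prod k m x s : is_product mul (fun=> True) m x -> (2 ^ k <= m)%N ->
    (forall f, f \in s -> mult_ops f) -> (N <= size s + k)%N -> act s x = 0.
  by move=> x xP; apply: (prod N (2 ^ N)%N x [::]).
move=> xP; elim: k m x s xP => [|k IH] m x s xP km sW sN.
  by apply/eqP; rewrite -memv0; apply: NP; rewrite ?memvf // -(addn0 (size s)).
have step f v j : mult_ops f -> is_product mul (fun=> True) j v -> (2 ^ k <= j)%N ->
    act s (f v) = 0.
  move=> Wf vP kj; rewrite -[act s _]/(act s (act [:: f] v)) -act_cat.
  apply: (IH j) => // [g|]; last by rewrite size_cat addn1 addSnnS.
  by rewrite mem_cat inE => /orP[/sW // | /eqP ->].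
case: xP km => [y _|p q y z yP zP].
  by rewrite leqNgt -[X in (X < _)%N](expn0 2) ltn_exp2l.
rewrite expnS mul2n -addnn => kpq; have [kp|pk] := leqP (2 ^ k) p.
  have yb0 i b : b \in A_ i -> act s (mul y b) = 0.
    move=> bi; rewrite -rmulE (step _ _ p) //; right.
    by exists b; split=> //; exists i.
  have [z0 [z1 [z0A z1A ->]]] := homogeneous_decomposition z.
  by rewrite linearDr linearD /= (yb0 _ _ z0A) (yb0 _ _ z1A) addr0.
have kq : (2 ^ k <= q)%N.
  by rewrite -(leq_add2l (2 ^ k)) (leq_trans kpq) // leq_add2r ltnW.
have bz0 i b : b \in A_ i -> act s (mul b z) = 0.
  by move=> bi; rewrite -LopE (step _ _ q) //; left; exists b; split=> //; exists i.
have [y0 [y1 [y0A y1A ->]]] := homogeneous_decomposition y.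
by rewrite linearDl linearD /= (bz0 _ _ y0A) (bz0 _ _ y1A) addr0.
Qed.

End Nilpotency.

(** Powers of [Rop] are among the products that vanish in the generated subalgebra. *)
Lemma engelian_Rop_nilpotent (F : fieldType) (A : vectType F) (mul : A -> A -> A)
    (A_ : bool -> {vspace A}) x :
  engelian_elt mul A_ x -> nilpotent_operator (Rop mul A_ x).
Proof.
case=> [[//|n] _ nP]; exists n.+1 => y.
set G := generated_subalgebra _ _ in nP; set R := Rop mul A_ x.
have [g [gP gE]] : exists g, is_product (@comp_lfun F A A A) G n.+1 g /\
    forall v, g v = iter n.+1 R v.
  have GR : G R by apply: gen_incl; left.
  elim: (n) => [|m [g [gP gE]]]; first by exists R; split=> //; exact: is_product1.
  exists (R \o g)%VF; split=> [|v]; last by rewrite comp_lfunE gE.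
  by rewrite -[m.+2]/(1 + m.+1)%N; apply: is_productM => //; exact: is_product1.
by rewrite -gE (nP g gP) zero_lfunE.
Qed.

Theorem theorem3p5 (F : fieldType) (A : vectType F)
    (mul : {bilinear A -> A -> A}) (A_ : bool -> {vspace A}) :
  alternative_superalgebra mul A_ ->
  ((forall a : A, homogeneous A_ a -> nilpotent_operator (Rop mul A_ a)) ->
     nilpotent_algebra mul)
  /\ (engelian mul A_ -> nilpotent_algebra mul).
Proof.
move=> altA; have main : (forall a : A, homogeneous A_ a ->
    nilpotent_operator (Rop mul A_ a)) -> nilpotent_algebra mul.
  move=> Rnil; apply: (nilpotent_of_rmul_nilpotent altA) => a ha.
  by apply: (rmul_nilpotent altA ha); exact: Rnil.
split=> // eng; apply: main => a ha; apply: engelian_Rop_nilpotent; exact: eng.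
Qed.
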